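(* Let $KB=(O,M)$ be a tightly coupled probabilistic $\mathcal{EL}^{++}$ ontology (TCP ontology) where $M$ is a ground conjunctive Markov logic network with $n$ ground atoms, and let $C_1,\dots,C_{2^{|M|}}$ be the equivalence classes of $M$ sorted in decreasing order of their score. Then, after analyzing $s$ worlds and $t$ classes with Algorithm anytimeRank, the total unassigned class score mass is bounded from above by $$U=(2^n-s)\cdot\exp\Bigl(\sum_{F_j\in M,\ C_{t+1}\models F_j}w_j\Bigr).$$
   Context: **Ground cMLN and classes.** A ground conjunctive Markov logic network (ground cMLN) is a finite list $M$ of pairs $(F_j,w_j)$, each $F_j$ a conjunction of ground atoms and $w_j\in\mathbb R$, over a finite set $X$ of $n$ ground atoms; $|M|$ is the number of formulas. A (possible) world is a truth assignment $\lambda:X\to\{0,1\}$, so there are $2^n$ worlds. $Sat(\lambda,M)$ is the set of formulas of $M$ satisfied by $\lambda$. Each subset $T$ of the formulas of $M$ determines an equivalence class $C=\{\lambda: Sat(\lambda,M)=T\}$ (possibly empty); thus there are $2^{|M|}$ classes, which partition the set of worlds. Write $C\models F_j$ iff $F_j\in T$. The score of the class $C$ is $\exp\bigl(\sum_{F_j\in M,\,C\models F_j}w_j\bigr)$; the score of a world is that of its class. **TCP ontology.** $O$ is a finite set of annotated formulas $F:\mu$, with $F$ (the first-order translation of) an axiom or assertion of the description logic $\mathcal{EL}^{++}$, and $\mu$ a finite set of pairs $\langle A_i,x_i\rangle$ with $A_i$ an atom over the MLN's predicates, constants and variables (the atoms of distinct pairs not unifiable) and $x_i\in\{0,1\}$.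 For a world $\lambda$, regarded as the set of pairs $\langle X_i,\lambda(X_i)\rangle$, the induced ontology is $O_\lambda=\{\theta F\mid F:\mu\in O,\ \theta\mu\subseteq\lambda\}$, where $\theta$ is a most general unifier of $\mu$ with (a part of) $\lambda$. **Algorithm anytimeRank.** It processes the classes in the order $C_1,C_2,\dots$ (decreasing score). Within each class it inspects the worlds one at a time, each once; for each inspected world $\lambda\in C_i$ it computes $O_\lambda$ and adds the score of $C_i$ to $score(a)$ (initially $0$) for every ground atom $a$ that is an atomic consequence of $O_\lambda$. It may be stopped at any time by a user-given stopping condition. **Meaning of the quantities.** ''After analyzing $s$ worlds and $t$ classes'' means that the algorithm has inspected exactly $s$ worlds in total and all worlds of $C_1,\dots,C_t$ have been inspected. The ''total unassigned class score mass'' is the sum of the scores of all worlds that have not been inspected. If $t=2^{|M|}$, then $s=2^n$ and $U$ is taken to be $0$. *)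

(* Defs.v *)
From Stdlib Require List.
From HB Require Import structures.
From mathcomp Require Import all_boot all_order all_algebra finmap.
From mathcomp Require Import boolp reals sequences exp.

Set Implicit Arguments.
Unset Strict Implicit.
Unset Printing Implicit Defensive.
Import Order.TTheory GRing.Theory Num.Theory.
Local Open Scope ring_scope.

Record concrete_domain := ConcreteDomain {
  cd_carrier : Type;
  cd_pred : Type;
  cd_arity : cd_pred -> nat;
  cd_ext : forall p : cd_pred, (cd_arity p).-tuple cd_carrier -> Prop
}.

(* Individuals of the description logic and constants of the Markov logic
   network share one type, since a substitution computed from a world is applied
   to ontology formulas.  EL++ without concrete domains is [n_domains = 0]. *)
Record vocabulary := Vocabulary {
  concept_name : Type;
  role_name : Type;
  feature_name : Type;
  n_domains : nat;
  domains : 'I_n_domains -> concrete_domain;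
  constant : choiceType;
  mln_pred : choiceType;
  mln_arity : mln_pred -> nat
}.

(* [inl x] is the variable named x, [inr c] is a constant. *)
Definition term (V : vocabulary) : choiceType := (nat + constant V)%type.

Definition subst (V : vocabulary) := nat -> term V.

Definition term_subst (V : vocabulary) (th : subst V) (u : term V) : term V :=
  match u with inl x => th x | inr c => inr c end.

Inductive concept (V : vocabulary) : Type :=
| Top
| Bot
| Nominal of constant V
| Atomic of concept_name V
| Inter of concept V & concept V
| Exist of role_name V & concept V
| Concrete (i : 'I_(n_domains V)) (p : cd_pred (domains i))
           (fs : (cd_arity p).-tuple (feature_name V)).
Arguments Top {V}.
Arguments Bot {V}.

(* [RoleInclusion r1 [:: r2; ...; rk] r] is the axiom r1 o r2 o ... o rk <= r. *)
Inductive axiom (V : vocabulary) : Type :=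
| ConceptInclusion of concept V & concept V
| RoleInclusion of role_name V & seq (role_name V) & role_name V
| ConceptAssertion of concept V & constant V
| RoleAssertion of role_name V & constant V & constant V.

(* Bound variables are de Bruijn indices and free ones are named, so applying a
   substitution never captures a variable. *)
Inductive fo_term (V : vocabulary) : Type :=
| Bound of nat
| Free of term V.
Arguments Bound {V}.

(* [FConcrete p fs t]: the features fs are all defined at t, and the tuple of
   their values belongs to p. *)
Inductive formula (V : vocabulary) : Type :=
| FTrue
| FFalse
| FConcept of concept_name V & fo_term V
| FRole of role_name V & fo_term V & fo_term V
| FEq of fo_term V & fo_term V
| FConcrete (i : 'I_(n_domains V)) (p : cd_pred (domains i))
            (fs : (cd_arity p).-tuple (feature_name V)) of fo_term V
| FAnd of formula V & formula V
| FImp of formula V & formula V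
| FExists of formula V.
Arguments FTrue {V}.
Arguments FFalse {V}.

Definition fo_const (V : vocabulary) (c : constant V) : fo_term V :=
  Free (inr c : term V).
Definition fo_var (V : vocabulary) (x : nat) : fo_term V := Free (inl x : term V).

Definition fo_lift (V : vocabulary) (t : fo_term V) : fo_term V :=
  match t with Bound k => Bound k.+1 | Free u => Free u end.

Fixpoint concept_formula (V : vocabulary) (C : concept V) (t : fo_term V) :
    formula V :=
  match C with
  | Top => FTrue
  | Bot => FFalse
  | Nominal c => FEq t (fo_const c)
  | Atomic A => FConcept A t
  | Inter C1 C2 => FAnd (concept_formula C1 t) (concept_formula C2 t)
  | Exist r C1 =>
      FExists (FAnd (FRole r (fo_lift t) (Bound 0)) (concept_formula C1 (Bound 0)))
  | Concrete i p fs => FConcrete fs t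
  end.

(* r1(x_k, x_(k+1)) /\ r2(x_(k+1), x_(k+2)) /\ ... *)
Fixpoint chain_formula (V : vocabulary) (k : nat) (r : role_name V)
    (rs : seq (role_name V)) : formula V :=
  let hd := FRole r (fo_var V k) (fo_var V k.+1) in
  match rs with
  | [::] => hd
  | r' :: rs' => FAnd hd (chain_formula k.+1 r' rs')
  end.

(* The leading universal quantifiers are left implicit: their variables
   x_0, x_1, ... stay free, so that they can be shared with an annotation and
   instantiated.  Fixing these names is no restriction, as annotations are free
   to use the same names or others. *)
Definition axiom_formula (V : vocabulary) (F : axiom V) : formula V :=
  match F with
  | ConceptInclusion C D =>
      FImp (concept_formula C (fo_var V 0)) (concept_formula D (fo_var V 0))
  | RoleInclusion r1 rs r =>
      FImp (chain_formula 0 r1 rs) (FRole r (fo_var V 0) (fo_var V (size rs).+1))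
  | ConceptAssertion C a => concept_formula C (fo_const a)
  | RoleAssertion r a b => FRole r (fo_const a) (fo_const b)
  end.

Definition fo_term_subst (V : vocabulary) (th : subst V) (t : fo_term V) :
    fo_term V :=
  match t with Bound k => Bound k | Free u => Free (term_subst th u) end.

Fixpoint formula_subst (V : vocabulary) (th : subst V) (G : formula V) :
    formula V :=
  match G with
  | FTrue => FTrue
  | FFalse => FFalse
  | FConcept A t => FConcept A (fo_term_subst th t)
  | FRole r t u => FRole r (fo_term_subst th t) (fo_term_subst th u)
  | FEq t u => FEq (fo_term_subst th t) (fo_term_subst th u)
  | FConcrete i p fs t => FConcrete fs (fo_term_subst th t)
  | FAnd G1 G2 => FAnd (formula_subst th G1) (formula_subst th G2)
  | FImp G1 G2 => FImp (formula_subst th G1) (formula_subst th G2)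
  | FExists G1 => FExists (formula_subst th G1)
  end.

Record interpretation (V : vocabulary) := Interpretation {
  int_dom : Type;
  int_nonempty : inhabited int_dom;
  int_const : constant V -> int_dom;
  int_concept : concept_name V -> int_dom -> Prop;
  int_role : role_name V -> int_dom -> int_dom -> Prop;
  int_feature : feature_name V -> int_dom ->
    option {i : 'I_(n_domains V) & cd_carrier (domains i)}
}.

(* [rho] values the named variables and [b] the de Bruijn indices. *)
Definition fo_term_eval (V : vocabulary) (I : interpretation V)
    (rho b : nat -> int_dom I) (t : fo_term V) : int_dom I :=
  match t with
  | Bound k => b k
  | Free (inl x) => rho x
  | Free (inr c) => int_const I c
  end.

Fixpoint holds (V : vocabulary) (I : interpretation V)
    (rho b : nat -> int_dom I) (G : formula V) : Prop :=
  match G with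
  | FTrue => True
  | FFalse => False
  | FConcept A t => int_concept A (fo_term_eval rho b t)
  | FRole r t u => int_role r (fo_term_eval rho b t) (fo_term_eval rho b u)
  | FEq t u => fo_term_eval rho b t = fo_term_eval rho b u
  | FConcrete i p fs t =>
      exists2 ys : (cd_arity p).-tuple (cd_carrier (domains i)),
        forall l, int_feature (tnth fs l) (fo_term_eval rho b t)
                  = Some (existT _ i (tnth ys l))
        & cd_ext ys
  | FAnd G1 G2 => holds rho b G1 /\ holds rho b G2
  | FImp G1 G2 => holds rho b G1 -> holds rho b G2
  | FExists G1 =>
      exists d, holds rho (fun k => if k is k'.+1 then b k' else d) G1
  end.

Definition is_model (V : vocabulary) (I : interpretation V) (G : formula V) :
    Prop :=
  forall rho b : nat -> int_dom I, holds rho b G.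

Definition entails (V : vocabulary) (T : formula V -> Prop) (G : formula V) :
    Prop :=
  forall I : interpretation V,
    (forall H, T H -> is_model I H) -> is_model I G.

Inductive ground_atom (V : vocabulary) : Type :=
| GConcept of concept_name V & constant V
| GRole of role_name V & constant V & constant V.

Definition atom_formula (V : vocabulary) (a : ground_atom V) : formula V :=
  match a with
  | GConcept A c => FConcept A (fo_const c)
  | GRole r c d => FRole r (fo_const c) (fo_const d)
  end.

Definition atomic_consequence (V : vocabulary) (T : formula V -> Prop)
    (a : ground_atom V) : Prop :=
  entails T (atom_formula a).

Definition mln_atom (V : vocabulary) : choiceType :=
  {p : mln_pred V & (mln_arity p).-tuple (term V)}.

Definition mln_ground_atom (V : vocabulary) : choiceType :=
  {p : mln_pred V & (mln_arity p).-tuple (constant V)}.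

(* A conjunction of ground atoms is the list of its conjuncts. *)
Record cmln (R : realType) (V : vocabulary) := CMLN {
  atoms : {fset mln_ground_atom V};
  formulas : seq (seq atoms * R)
}.

Section MLN.
Variables (R : realType) (V : vocabulary) (M : cmln R V).

Definition world := {ffun atoms M -> bool}.

(* The formulas of M are referred to by their position, so that a formula
   occurring twice counts twice. *)
Definition formula_index := 'I_(size (formulas M)).

Definition conj_of (j : formula_index) : seq (atoms M) :=
  (tnth (in_tuple (formulas M)) j).1.
Definition weight (j : formula_index) : R := (tnth (in_tuple (formulas M)) j).2.

Definition Sat (w : world) : {set formula_index} := [set j | all w (conj_of j)].

(* An equivalence class is named by the set of formulas that it satisfies, so
   there are 2^|M| of them, and "C |= F_j" is [j \in C]. *)
Definition eqclass := {set formula_index}.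

Definition worlds_of (C : eqclass) : {set world} := [set w | Sat w == C].

Definition class_score (C : eqclass) : R := expR (\sum_(j in C) weight j).

Definition world_score (w : world) : R := class_score (Sat w).

Definition sorted_classes (Cs : seq eqclass) : Prop :=
  perm_eq Cs (enum {: eqclass})
  /\ sorted (fun C D => class_score D <= class_score C) Cs.

Definition world_pair (w : world) (q : mln_ground_atom V * bool) : Prop :=
  exists x : atoms M, q = (val x, w x).

End MLN.

Section Unification.
Variable V : vocabulary.

Definition atom_subst (th : subst V) (A : mln_atom V) : mln_atom V :=
  existT _ (tag A) (map_tuple (term_subst th) (tagged A)).

Definition ground (g : mln_ground_atom V) : mln_atom V :=
  existT _ (tag g) (map_tuple (fun c => inr c : term V) (tagged g)).

Definition is_unifier (E : mln_atom V * mln_atom V -> Prop) (th : subst V) :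
    Prop :=
  forall e, E e -> atom_subst th e.1 = atom_subst th e.2.

Definition is_mgu (E : mln_atom V * mln_atom V -> Prop) (th : subst V) : Prop :=
  is_unifier E th /\
  forall si : subst V, is_unifier E si ->
    exists de : subst V, forall x, si x = term_subst de (th x).

Definition unifiable (A B : mln_atom V) : Prop :=
  exists th : subst V, atom_subst th A = atom_subst th B.

End Unification.

Record annotated_formula (V : vocabulary) := Annotated {
  af_axiom : axiom V;
  af_annot : {fset mln_atom V * bool};
  af_not_unifiable : forall p q, p \in af_annot -> q \in af_annot -> p != q ->
    ~ unifiable p.1 q.1
}.

(* The order and multiplicity in [ontology] play no role: only membership in it
   is ever used. *)
Record tcp_ontology (R : realType) (V : vocabulary) := TCP {
  ontology : seq (annotated_formula V);
  mln : cmln R V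
}.

Section Ranking.
Variables (R : realType) (V : vocabulary) (KB : tcp_ontology R V).
Let M := mln KB.

Definition annot_sub (th : subst V) (mu : {fset mln_atom V * bool})
    (w : world M) : Prop :=
  forall p, p \in mu ->
    exists2 q, world_pair w q & atom_subst th p.1 = ground q.1 /\ p.2 = q.2.

(* The part of w with which th unifies mu is th mu: each atom of mu is unified
   with the ground atom that is its image. *)
Definition annot_eqs (th : subst V) (mu : {fset mln_atom V * bool})
    (e : mln_atom V * mln_atom V) : Prop :=
  exists2 p, p \in mu & e = (p.1, atom_subst th p.1).

Definition induced_ontology (w : world M) (G : formula V) : Prop :=
  exists (F : annotated_formula V) (th : subst V),
    [/\ List.In F (ontology KB),
        annot_sub th (af_annot F) w,
        is_mgu (annot_eqs th (af_annot F)) th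
      & G = formula_subst th (axiom_formula (af_axiom F))].

(* [cur] is the 0-based position of the class being processed. *)
Record rank_state := RankState {
  cur : nat;
  inspected : {set world M};
  rscore : ground_atom V -> R
}.

Definition rank_init : rank_state := RankState 0 finset.set0 (fun=> 0).

Definition nth_class (Cs : seq (eqclass M)) (i : nat) : eqclass M :=
  nth finset.set0 Cs i.

Inductive rank_step (Cs : seq (eqclass M)) : rank_state -> rank_state -> Prop :=
| RankInspect (st : rank_state) (w : world M) :
    (cur st < size Cs)%N ->
    w \in worlds_of (nth_class Cs (cur st)) ->
    w \notin inspected st ->
    rank_step Cs st
      (RankState (cur st) (w |: inspected st)%SET
         (fun a => rscore st a +
            (if `[< atomic_consequence (induced_ontology w) a >]
             then class_score (nth_class Cs (cur st)) else 0)))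
| RankNextClass (st : rank_state) :
    (cur st < size Cs)%N ->
    worlds_of (nth_class Cs (cur st)) \subset inspected st ->
    rank_step Cs st (RankState (cur st).+1 (inspected st) (rscore st)).

(* The states in which the algorithm can be stopped: the order of the worlds
   within a class and the stopping condition are arbitrary. *)
Inductive anytimeRank (Cs : seq (eqclass M)) : rank_state -> Prop :=
| RankStart : anytimeRank Cs rank_init
| RankStep st st' :
    anytimeRank Cs st -> rank_step Cs st st' -> anytimeRank Cs st'.

Definition analyzed (Cs : seq (eqclass M)) (st : rank_state) (s t : nat) : Prop :=
  [/\ #|inspected st| = s,
      (t <= 2 ^ size (formulas M))%N
    & forall i, (i < t)%N -> worlds_of (nth_class Cs i) \subset inspected st].

Definition unassigned_mass (st : rank_state) : R :=
  \sum_(w : world M | w \notin inspected st) world_score w.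

End Ranking.

(* Main.v *)
(* The world inspection order never matters: a world that has not been inspected
   lies in a class at a position at least t, so its score is at most the score of
   C_(t+1), and exactly 2^n - s worlds have not been inspected. *)
Require Import Defs.
From HB Require Import structures.
From mathcomp Require Import all_boot all_order all_algebra finmap.
From mathcomp Require Import boolp reals sequences exp.
Import Order.TTheory GRing.Theory Num.Theory.
Local Open Scope ring_scope.

Lemma card_world (R : realType) (V : vocabulary) (M : cmln R V) :
  #|{: world M}| = (2 ^ #|` atoms M|)%N.
Proof. by rewrite card_ffun card_bool cardfE. Qed.

(** A class is any subset of formula positions, even one no world realises, so a power set is
    counted. *)
Lemma size_sorted_classes (R : realType) (V : vocabulary) (M : cmln R V)
    (Cs : seq (eqclass M)) :
  sorted_classes Cs -> size Cs = (2 ^ size (formulas M))%N.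
Proof.
by case=> /perm_size -> _; rewrite -cardT -cardsT -powersetT card_powerset cardsT
  card_ord.
Qed.

Lemma class_score_nth_le (R : realType) (V : vocabulary)
    (KB : tcp_ontology R V) (Cs : seq (eqclass (mln KB))) (i j : nat) :
  sorted_classes Cs -> (i <= j < size Cs)%N ->
  class_score (nth_class Cs j) <= class_score (nth_class Cs i).
Proof.
case=> _ Cs_sorted /andP[le_ij lt_j].
apply: (sorted_leq_nth _ _ finset.set0 Cs_sorted) => //.
- by move=> D C E DC ED; apply: le_trans ED DC.
- exact: leq_ltn_trans le_ij lt_j.
Qed.

(** [Cs] enumerates every set of formula positions, so [Sat w] occurs in it; were its index below
    [t], its whole class, [w] included, would be inspected. *)
Lemma uninspected_class_index (R : realType) (V : vocabulary)
    (KB : tcp_ontology R V) (Cs : seq (eqclass (mln KB))) (st : rank_state KB)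
    (s t : nat) (w : world (mln KB)) :
  sorted_classes Cs -> analyzed Cs st s t -> w \notin inspected st ->
  exists2 i, (t <= i < size Cs)%N & nth_class Cs i = Sat w.
Proof.
move=> [Cs_perm _] [_ _ done_t] wNst.
have w_Cs : Sat w \in Cs by rewrite (perm_mem Cs_perm) mem_enum.
exists (index (Sat w) Cs); last exact: nth_index.
rewrite index_mem w_Cs andbT leqNgt; apply: contra wNst => /done_t/subsetP.
by apply; rewrite inE /nth_class nth_index.
Qed.

(* C_(t+1) is [nth_class Cs t], positions in Cs being counted from 0. *)
Theorem proposition2 (R : realType) (V : vocabulary) (KB : tcp_ontology R V)
    (n : nat) (hn : n = #|` atoms (mln KB)|)
    (Cs : seq (eqclass (mln KB))) (hCs : sorted_classes Cs)
    (st : rank_state KB) (hst : anytimeRank Cs st)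
    (s t : nat) (hstt : analyzed Cs st s t) :
  unassigned_mass st <=
    if (t < 2 ^ size (formulas (mln KB)))%N
    then (2 ^+ n - s%:R) * expR (\sum_(j in nth_class Cs t) weight j)
    else 0.
Proof.
have [card_st _ _] := hstt.
have index_ge (w : world (mln KB)) := uninspected_class_index _ _ _ _ _ _ _ w hCs hstt.
case: ifPn => [lt_t | ge_t]; last first.
  (* Once [t] reaches the number of classes, no position is left for the class of an uninspected
     world, so the sum is empty. *)
  rewrite /unassigned_mass big_pred0 // => w; apply/negbTE/negP => /index_ge[i].
  rewrite (size_sorted_classes _ _ _ _ hCs) => /andP[le_ti lt_i] _.
  by rewrite (leq_ltn_trans le_ti lt_i) in ge_t.
have score_le w : w \notin inspected st ->
    world_score w <= class_score (nth_class Cs t).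
  by move=> /index_ge[i ti w_i]; rewrite /world_score -w_i; apply: class_score_nth_le.
(* The real difference is the cardinality of the complement of [inspected st]. *)
have cardC : (2 ^+ n - s%:R : R) = #|[pred w | w \notin inspected st]|%:R.
  rewrite -natrX hn -card_world -(cardC [in inspected st]) card_st natrD addrAC.
  by rewrite subrr add0r.
(* The bound becomes a constant sum over the uninspected worlds, compared term by term. *)
by rewrite cardC mulr_natl -sumr_const; apply: ler_sum.
Qed.
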